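(* Let $r\ge 1$, $n\ge 0$, $k\ge 0$ be integers and let $\Theta\in(\mathbb{Y}^r)_n$. The deletion-insertion map $\phi_{r,n}^k$ defined in the context is a bijection $$\phi_{r,n}^k:\ \mathcal{E}(\Theta)\times([n]\times[r])^k\longrightarrow\bigsqcup_{\Lambda\in(\mathbb{Y}^r)_n}\mathcal{E}(\Lambda)\times\mathcal{VT}_k(\Theta\rightarrow\Lambda).$$ Moreover, if $n\ge 1$, the map obtained from $\phi_{r,n}^k$ by replacing each image $(\Gamma_k,\Delta)$ by $(\Gamma',\Delta')$, where $\Gamma'$ is $\Gamma_k$ with the square containing $n$ removed and $\Delta'$ is $\Delta$ with the shape of $\Gamma'$ appended at the end, is a bijection $$\mathcal{E}(\Theta)\times([n]\times[r])^k\longrightarrow\bigsqcup_{\Lambda\in(\mathbb{Y}^r)_{n-1}}\mathcal{E}(\Lambda)\times\mathcal{VT}_{k+\frac12}(\Theta\rightarrow\Lambda).$$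
   Context: $[n]=\{1,\dots,n\}$. $\mathbb{Y}$ is Young's lattice: all integer partitions (identified with Young diagrams) ordered by inclusion. $\mathbb{Y}^r$ is the set of $r$-tuples $\Lambda=(\lambda^{(1)},\dots,\lambda^{(r)})$ of partitions ordered componentwise by inclusion; its minimum is $(\emptyset,\dots,\emptyset)$, the rank of $\Lambda$ is $|\lambda^{(1)}|+\cdots+|\lambda^{(r)}|$, and $(\mathbb{Y}^r)_n$ is the set of elements of rank $n$. $\Lambda$ covers $\Theta$ iff $\Lambda$ is obtained from $\Theta$ by adding one square to exactly one component. A partial tableau is a filling of a Young diagram with distinct integers, increasing along rows and columns. For $\Lambda\in(\mathbb{Y}^r)_n$, $\mathcal{E}(\Lambda)$ is the set of $r$-tuples $(T^{(1)},\dots,T^{(r)})$ of partial tableaux with $T^{(i)}$ of shape $\lambda^{(i)}$ and such that the set of all entries of $T^{(1)},\dots,T^{(r)}$ is exactly $[n]$ (each of these entries occurs once); such tuples encode the saturated chains from $\hat 0$ to $\Lambda$. $\mathcal{VT}_k(\Theta\rightarrow\Lambda)$ is the set of sequences $\Theta=\Lambda_0\supseteq\Lambda_{1/2}\subseteq\Lambda_1\supseteq\cdots\supseteq\Lambda_{k-1/2}\subseteq\Lambda_k=\Lambda$ in $\mathbb{Y}^r$ in which consecutive elements differ by a covering relation (alternating down and up steps, $2k$ steps in total). $\mathcal{VT}_{k+\frac12}(\Theta\rightarrow\Lambda)$ is the set of such sequences with one further down step, $\Theta=\Lambda_0\supseteq\Lambda_{1/2}\subseteq\cdots\subseteq\Lambda_k\supseteq\Lambda_{k+1/2}=\Lambda$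 ($2k+1$ steps). Definition of $\phi_{r,n}^k$. An element $(i,c)\in[n]\times[r]$ is viewed as the integer $i$ with color $c$. Given $\Gamma_0\in\mathcal{E}(\Theta)$ and a sequence $\boldsymbol{i}=(i_1,\dots,i_k)$ of colored integers, where $i_j$ has value in $[n]$ and color $c(i_j)\in[r]$, define $r$-tuples of partial tableaux iteratively for $j=1,\dots,k$: (1) $\Gamma_{j-\frac12}$ is obtained from $\Gamma_{j-1}$ by removing the square containing $n$; (2) $\Gamma_j$ is obtained from $\Gamma_{j-\frac12}$ by first adding $1$ to every entry $i$ of the tableaux of $\Gamma_{j-\frac12}$ with $i\ge i_j$, and then inserting $i_j$ into the $t$-th tableau, $t=c(i_j)$, by RSK row insertion. Then $\phi_{r,n}^k(\Gamma_0,\boldsymbol{i})=(\Gamma_k,\Delta)$, where $\Delta$ is the sequence of shapes ($r$-tuples of partitions) of $(\Gamma_0,\Gamma_{\frac12},\Gamma_1,\dots,\Gamma_k)$. *)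

(* Defs.v *)
From mathcomp Require Import all_boot classical_sets functions.
Set Implicit Arguments.
Unset Strict Implicit.
Unset Printing Implicit Defensive.

Local Open Scope classical_set_scope.

(* Partitions are weakly decreasing lists of positive integers, and a filling
   of a Young diagram is the list of its rows, top to bottom. *)

Definition is_part (l : seq nat) : bool := sorted geq l && (0 \notin l).

Definition rank r (L : {ffun 'I_r -> seq nat}) : nat := \sum_(t < r) sumn (L t).

Definition Yr r : set {ffun 'I_r -> seq nat} :=
  [set L | forall t, is_part (L t)].

Definition Yr_rank r n : set {ffun 'I_r -> seq nat} :=
  [set L | Yr L /\ rank L = n].

(* Only meant for L, M in Yr r: requiring M to be a partition then forces the
   square added at the end of row p to be an outer corner. *)
Definition covers r (M L : {ffun 'I_r -> seq nat}) : Prop :=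
  exists t p, M = [ffun u => if u == t then incr_nth (L u) p else L u].

(* VT m Theta Lambda is the set usually indexed by the half-integer m / 2: m is
   the number of steps, and the element of index j / 2 is at position j. *)
Definition VT r m (Theta Lambda : {ffun 'I_r -> seq nat}) :
    set (seq {ffun 'I_r -> seq nat}) :=
  [set D | [/\ size D = m.+1,
               forall j, j <= m -> Yr (nth Theta D j),
               nth Theta D 0 = Theta,
               nth Theta D m = Lambda &
               forall j, j < m ->
                 if odd j then covers (nth Theta D j.+1) (nth Theta D j)
                 else covers (nth Theta D j) (nth Theta D j.+1)]].

Definition partial_tableau (T : seq (seq nat)) : Prop :=
  [/\ is_part (shape T),
      uniq (flatten T),
      all (sorted ltn) T &
      forall i j, j < size (nth [::] T i.+1) ->
        nth 0 (nth [::] T i) j < nth 0 (nth [::] T i.+1) j].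

Definition tuple_shape r (G : {ffun 'I_r -> seq (seq nat)}) :
    {ffun 'I_r -> seq nat} :=
  [ffun t => shape (G t)].

Definition entries r (G : {ffun 'I_r -> seq (seq nat)}) : seq nat :=
  flatten [seq flatten (G t) | t <- enum 'I_r].

Definition E r (L : {ffun 'I_r -> seq nat}) :
    set {ffun 'I_r -> seq (seq nat)} :=
  [set G : {ffun 'I_r -> seq (seq nat)} | [/\ forall t, partial_tableau (G t),
               tuple_shape G = L &
               perm_eq (entries G) (iota 1 (rank L))]].

Fixpoint row_insert (x : nat) (T : seq (seq nat)) : seq (seq nat) :=
  if T is row :: T' then
    let p := find (ltn x) row in
    if p < size row then set_nth 0 row p x :: row_insert (nth 0 row p) T'
    else rcons row x :: T'
  else [:: [:: x]].

(* Rows that become empty are dropped, so that shapes have no zero part. *)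
Definition tab_remove (n : nat) (T : seq (seq nat)) : seq (seq nat) :=
  [seq row <- [seq [seq y <- row | y != n] | row <- T] | row != [::]].

Definition remove r (n : nat) (G : {ffun 'I_r -> seq (seq nat)}) :
    {ffun 'I_r -> seq (seq nat)} :=
  [ffun t => tab_remove n (G t)].

(* [bump i y] is y.+1 if i <= y and y otherwise. *)
Definition shift r (i : nat) (G : {ffun 'I_r -> seq (seq nat)}) :
    {ffun 'I_r -> seq (seq nat)} :=
  [ffun t => [seq [seq bump i y | y <- row] | row <- G t]].

Definition insert r (x : nat * 'I_r) (G : {ffun 'I_r -> seq (seq nat)}) :
    {ffun 'I_r -> seq (seq nat)} :=
  [ffun t => if t == x.2 then row_insert x.1 (shift x.1 G t)
             else shift x.1 G t].

Definition colored_words r n k : set (seq (nat * 'I_r)) :=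
  [set s | size s = k /\ all (fun x => 1 <= x.1 <= n) s].

(* The sequence G_0, G_{1/2}, G_1, ..., G_k with k = size s. *)
Fixpoint del_ins r (n : nat) (G : {ffun 'I_r -> seq (seq nat)})
    (s : seq (nat * 'I_r)) : seq {ffun 'I_r -> seq (seq nat)} :=
  if s is x :: s' then
    let H := remove n G in G :: H :: del_ins n (insert x H) s'
  else [:: G].

Definition phi r n
    (u : {ffun 'I_r -> seq (seq nat)} * seq (nat * 'I_r)) :
    {ffun 'I_r -> seq (seq nat)} * seq {ffun 'I_r -> seq nat} :=
  let Gs := del_ins n u.1 u.2 in (last u.1 Gs, map (@tuple_shape r) Gs).

Definition phi_half r n
    (u : {ffun 'I_r -> seq (seq nat)} * seq (nat * 'I_r)) :
    {ffun 'I_r -> seq (seq nat)} * seq {ffun 'I_r -> seq nat} :=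
  let G' := remove n (phi n u).1 in (G', rcons (phi n u).2 (tuple_shape G')).

(* The sets E L `*` VT m Theta L are pairwise disjoint, so that their disjoint
   union over L may be rendered by \bigcup. *)
Lemma trivIset_E_VT r m (Theta : {ffun 'I_r -> seq nat}) :
  trivIset setT (fun L => E L `*` VT m Theta L).
Proof.
move=> L M _ _ [[G D]] /= [[_ [_ _ _ <- _]] [_ [_ _ _ <- _]]].
by [].
Qed.

(* Main.v *)
Require Import Defs.
From mathcomp Require Import all_boot classical_sets functions zify.

Set Implicit Arguments.
Unset Strict Implicit.

(** Each step of the deletion-insertion process is invertible once the shapes
    before and after it are known, and the whole map is a bijection because
    Delta records exactly these shapes.

    A deletion step removes the largest entry n, which sits in a corner of
    one component. The two shapes differ by that corner, so putting n back
    there recovers the tuple ([remove_inj]); conversely n may be put in any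
    corner whose addition gives a partition, because it exceeds every other
    entry ([remove_surj]).

    An insertion step is RSK row insertion into one component. The two shapes
    tell the component and the row where the bumping path ends, and running the
    bumping backwards from there recovers the tableau and the inserted letter
    ([row_insert_inj], [row_insert_surj]). The letter i lost by the relabelling
    y -> bump i y is the inserted one, so that the relabelling is undone as well
    ([insert_inj], [insert_surj]).

    The statement on k letters follows by induction on k, peeling the first
    letter together with the first two steps of the walk ([del_ins_inj],
    [del_ins_surj]). The variant that ends with a deletion composes this
    bijection with one more invertible step. *)

(** * Tableaux row by row *)

(** The adjacency condition between consecutive rows of a tableau; with
    [r2 = [::]] it holds trivially, which lets [head [::] T'] stand for the next
    row in [tableau]. *)
Definition above (r1 r2 : seq nat) : Prop :=
  size r2 <= size r1 /\ forall j, j < size r2 -> nth 0 r1 j < nth 0 r2 j.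

(** The same condition as in [partial_tableau] without distinctness of the
    entries, but by recursion on rows, as row insertion proceeds. *)
Fixpoint tableau (T : seq (seq nat)) : Prop :=
  if T is row :: T' then
    [/\ row != [::], sorted ltn row, above row (head [::] T') & tableau T']
  else True.

Lemma is_part_cons a l :
  is_part (a :: l) = [&& 0 < a, head 0 l <= a & is_part l].
Proof.
rewrite /is_part inE negb_or eq_sym -lt0n; case: l => [|b l] /=.
  by rewrite andbT.
by case: (b <= a); case: (0 < a); rewrite /= ?andbF.
Qed.

Lemma head_shape (T : seq (seq nat)) : head 0 (shape T) = size (head [::] T).
Proof. by case: T. Qed.

Lemma tableauP T :
  tableau T <-> [/\ is_part (shape T), all (sorted ltn) T &
    forall i j, j < size (nth [::] T i.+1) ->
      nth 0 (nth [::] T i) j < nth 0 (nth [::] T i.+1) j].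
Proof.
elim: T => [|row T IH]; first by split=> // _; split=> // i j; rewrite !nth_nil.
rewrite [shape _]/= is_part_cons head_shape /= lt0n size_eq0; split.
  case=> -> -> [-> lt_col] /IH [-> -> cols];
    split=> // -[|i] j /=; last exact: cols.
  by rewrite nth0; apply: lt_col.
case=> /and3P [-> le_sz part_T] /andP [-> sorted_T] cols; split=> //.
  by split=> // j; rewrite -nth0; apply: (cols 0).
by apply/IH; split=> // i j; apply: (cols i.+1).
Qed.

Lemma partial_tableauP T : partial_tableau T <-> uniq (flatten T) /\ tableau T.
Proof.
split; first by case=> *; split=> //; apply/tableauP.
by case=> uT /tableauP [].
Qed.

(** * Bumping in one row *)

Lemma nth_set_nth0 s p x j :
  nth 0 (set_nth 0 s p x) j = if j == p then x else nth 0 s j.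
Proof. by rewrite nth_set_nth. Qed.

Lemma sorted_lt_nth s i j : sorted ltn s -> i < j -> j < size s ->
  nth 0 s i < nth 0 s j.
Proof.
move=> s_sorted lt_ij lt_j.
by apply: (sorted_ltn_nth ltn_trans) => //; rewrite inE // (ltn_trans lt_ij).
Qed.

(** [find (ltn x) s] is the position where [x] enters the row [s]; it equals
    [size s] when [x] goes to the end. *)
Lemma find_ltn_before x s j : x \notin s -> j < find (ltn x) s -> nth 0 s j < x.
Proof.
move=> xNs lt_j; have /negbT := before_find 0 lt_j.
have /memPn/(_ _ (mem_nth 0 (leq_trans lt_j (find_size (ltn x) s)))) := xNs.
rewrite /=; lia.
Qed.

Lemma find_ltn_at x s : find (ltn x) s < size s -> x < nth 0 s (find (ltn x) s).
Proof. by rewrite -has_find => /(nth_find 0). Qed.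

Lemma find_ltnP x s p : p < size s -> x < nth 0 s p ->
  (forall j, j < p -> nth 0 s j <= x) -> find (ltn x) s = p.
Proof.
move=> lt_p lt_x le_x; case: (ltngtP (find (ltn x) s) p) => // [lt_f | lt_pf].
  have := @find_ltn_at x s; have := le_x _ lt_f; lia.
by have /= := before_find 0 lt_pf; rewrite lt_x.
Qed.

(** When [find] returns [size s], [set_nth] appends [x], so the statement covers
    both ways of entering a row. *)
Lemma sorted_bump x s : sorted ltn s -> x \notin s ->
  sorted ltn (set_nth 0 s (find (ltn x) s) x).
Proof.
move=> s_sorted xNs; apply/(sortedP 0) => i; rewrite size_set_nth !nth_set_nth0 => lt_i.
have fs := find_size (ltn x) s.
case: eqP => [ei|ni]; case: eqP => [ei1|ni1]; try lia.
- have lt_f : find (ltn x) s < size s by lia.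
  have := find_ltn_at lt_f; have := @sorted_lt_nth s i i.+1 s_sorted.
  rewrite -ei; lia.
- by apply: find_ltn_before; rewrite // -ei1.
- by apply: sorted_lt_nth => //; lia.
Qed.

(** The bumping path moves weakly to the left: the entry below the bumped [y]
    exceeds [y], so [y] enters the next row at a column at most [p]. Entries of
    the upper row only decrease, and the single new entry [y] of the lower row
    lies below an entry smaller than [y]. *)
Lemma above_bump x row row2 : sorted ltn row -> above row row2 ->
    find (ltn x) row < size row ->
    let p := find (ltn x) row in let y := nth 0 row p in
  above (set_nth 0 row p x) (set_nth 0 row2 (find (ltn y) row2) y).
Proof.
move=> row_sorted [le_sz lt_col] lt_p p y.
have lt_xy : x < y by apply: find_ltn_at.
set q := find _ _; have le_q : q <= size row2 by apply: find_size.
have le_qp : q <= p.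
  case: leqP => // lt_pq; have /= := before_find 0 lt_pq.
  by rewrite lt_col ?(leq_trans lt_pq).
split=> [|j]; rewrite !size_set_nth; first by rewrite -/p in lt_p *; lia.
rewrite !nth_set_nth0 => lt_j.
case: eqP => [ejp|njp]; case: eqP => [ejq|njq] //.
- apply: (ltn_trans lt_xy); rewrite /y -ejp; apply: lt_col; lia.
- by apply: sorted_lt_nth => //; lia.
- by apply: lt_col; lia.
Qed.

(** Reverse bumping: [y] leaves the lower row and takes, in the upper row, the
    place of the largest entry [x] smaller than [y]. Such an entry exists because
    the one above [y] is smaller than [y]. *)
Lemma above_unbump row2 y row' : sorted ltn row' -> sorted ltn row2 ->
    y \notin row' -> y \notin row2 ->
    above row' (set_nth 0 row2 (find (ltn y) row2) y) ->
  exists row x, let p := find (ltn x) row in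
    [/\ sorted ltn row, above row row2, p < size row,
        nth 0 row p = y & row' = set_nth 0 row p x].
Proof.
move=> sorted' sorted2 yN' yN2; set q := find _ row2.
have le_q : q <= size row2 by apply: find_size.
have at_q : q < size row2 -> y < nth 0 row2 q by apply: find_ltn_at.
case; rewrite size_set_nth => le_sz lt_col.
have lt_q : nth 0 row' q < y.
  have := lt_col q; rewrite nth_set_nth0 eqxx; apply; lia.
(* The entries of row' smaller than y are those before position f, so the
   largest of them is at f.-1. *)
set f := find (ltn y) row'.
have le_f : f <= size row' by apply: find_size.
have lt_qf : q < f.
  rewrite ltnNge; apply/negP => le_fq; have : y < nth 0 row' f by apply: find_ltn_at; lia.
  have := @sorted_lt_nth row' f q sorted'; case: (eqVneq f q) => [->|]; lia.
pose p := f.-1; pose x := nth 0 row' p.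
have lt_xy : x < y by apply: find_ltn_before => //; lia.
have lt_p : p < size row' by lia.
have after j : p < j -> j < size row' -> y < nth 0 row' j.
  move=> lt_pj lt_j; have : y < nth 0 row' f by apply: find_ltn_at; lia.
  have := @sorted_lt_nth row' f j sorted'; case: (eqVneq f j) => [->|]; lia.
exists (set_nth 0 row' p y), x.
have -> : find (ltn x) (set_nth 0 row' p y) = p.
  apply: find_ltnP; rewrite ?size_set_nth ?nth_set_nth0 ?eqxx //; first lia.
  move=> j lt_j; rewrite nth_set_nth0; have := @sorted_lt_nth row' j p sorted' lt_j lt_p.
  rewrite -/x; case: eqP; lia.
split; rewrite ?size_set_nth ?nth_set_nth0 ?eqxx //; last 2 first.
- lia.
- apply: (@eq_from_nth _ 0); rewrite ?size_set_nth; first lia.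
  by move=> j _; rewrite !nth_set_nth0; case: eqP => // ->.
- apply/(sortedP 0) => i; rewrite size_set_nth !nth_set_nth0 => lt_i.
  have lt_i1 : i.+1 < size row' by lia.
  case: eqP => [ei|ni]; case: eqP => [ei1|ni1]; try lia.
  + by apply: after => //; lia.
  + by apply: (leq_trans _ lt_xy); rewrite ltnS ltnW // /x -ei1 sorted_lt_nth.
  + exact: sorted_lt_nth.
- split=> [|j lt_j]; first by rewrite size_set_nth; lia.
  rewrite nth_set_nth0; have := lt_col j; rewrite nth_set_nth0.
  case: (eqVneq j q) => [ejq|njq]; case: eqP => [ejp|njp]; try by move=> H; apply: H; lia.
  + by rewrite ejq => _; apply: at_q; rewrite -ejq.
  + by move=> H; apply: (leq_trans (H _)); [lia | rewrite ejq ltnW // at_q // -ejq].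
  + by have := @sorted_lt_nth row2 q j sorted2; have := at_q; lia.
Qed.

Lemma perm_bump x s p : p < size s ->
  perm_eq (nth 0 s p :: set_nth 0 s p x) (x :: s).
Proof.
move=> lt_p; rewrite set_nthE lt_p; apply/permP => a.
have := congr1 (count a) (cat_take_drop p s).
by rewrite (drop_nth 0 lt_p) /= !count_cat /=; lia.
Qed.

(** * Row insertion into one tableau *)

Lemma row_insert_cons x row T :
  row_insert x (row :: T) =
    let p := find (ltn x) row in
    if p < size row then set_nth 0 row p x :: row_insert (nth 0 row p) T
    else rcons row x :: T.
Proof. by []. Qed.

Lemma rcons_set_nth (s : seq nat) x : rcons s x = set_nth 0 s (size s) x.
Proof. by rewrite set_nthE ltnn subnn cats1. Qed.

(** The first row changes in the same way whether [x] bumps or is appended,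
    since [set_nth] extends the row when the position is its size. *)
Lemma head_row_insert x T :
  head [::] (row_insert x T) =
    set_nth 0 (head [::] T) (find (ltn x) (head [::] T)) x.
Proof.
case: T => [//|row T]; rewrite row_insert_cons /=; case: ltnP => //= le_p.
by rewrite rcons_set_nth; congr set_nth; apply/eqP; rewrite eqn_leq le_p find_size.
Qed.

Lemma perm_row_insert x T :
  perm_eq (flatten (row_insert x T)) (x :: flatten T).
Proof.
elim: T x => [//|row T IH] x; rewrite row_insert_cons /=.
case: ltnP => [lt_p|_] /=; last by rewrite -cats1 -catA -cat1s perm_catCA.
apply: (@perm_trans _ (set_nth 0 row (find (ltn x) row) x
                         ++ nth 0 row (find (ltn x) row) :: flatten T)).
  by rewrite perm_cat2l.
rewrite -cat1s perm_catCA /= -!cat_cons perm_cat2r.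
exact: perm_bump.
Qed.

Lemma shape_row_insert x T :
  exists p, shape (row_insert x T) = incr_nth (shape T) p.
Proof.
elim: T x => [|row T IH] x; first by exists 0.
rewrite row_insert_cons /=; case: ltnP => [lt_p|_] /=; last first.
  by exists 0; rewrite size_rcons.
have [p ->] := IH (nth 0 row (find (ltn x) row)).
by exists p.+1; rewrite size_set_nth (maxn_idPr lt_p).
Qed.

Lemma tableau_row_insert x T : tableau T -> uniq (x :: flatten T) ->
  tableau (row_insert x T).
Proof.
elim: T x => [|row T IH] x; first by [].
case=> row_n0 row_sorted above_T tab_T uniq_xT.
have xNrow : x \notin row.
  by move: uniq_xT; rewrite /= mem_cat negb_or => /andP [/andP [->]].
rewrite row_insert_cons /=; case: ltnP => [lt_p|le_p] /=.
  split.
  - by rewrite -size_eq0 size_set_nth; lia.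
  - exact: sorted_bump.
  - by rewrite head_row_insert; apply: above_bump.
  apply: IH => //; move: uniq_xT => /= /andP [_].
  rewrite cat_uniq => /and3P [_ /hasPn disj ->]; rewrite andbT.
  by apply/negP => /disj; rewrite mem_nth.
split=> //.
- by rewrite -size_eq0 size_rcons.
- have := sorted_bump row_sorted xNrow.
  rewrite rcons_set_nth (_ : find _ _ = size row) //.
  by apply/eqP; rewrite eqn_leq le_p find_size.
case: above_T => le_sz lt_col; split=> [|j lt_j]; first by rewrite size_rcons; lia.
by rewrite nth_rcons (leq_trans lt_j le_sz) lt_col.
Qed.

(** The sizes of the first rows tell whether the insertions bumped in row one. If
    both did, the letters passed on agree by induction, say equal to [y]; in the
    new first row the inserted letter is the last entry smaller than [y], so it
    sits at the same position in both cases. *)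
Lemma row_insert_inj T T1 x x1 : tableau T -> tableau T1 ->
  shape T = shape T1 -> row_insert x T = row_insert x1 T1 ->
  T = T1 /\ x = x1.
Proof.
elim: T T1 x x1 => [|row T IH] [|row1 T1] x x1 //; first by move=> _ _ _ [->].
case=> _ row_sorted _ tab_T [_ row1_sorted _ tab_T1] [eq_sz eq_sh].
rewrite !row_insert_cons /=.
case: ifP => lt_p; case: ifP => lt_p1.
- case=> eq_row /(IH _ _ _ tab_T tab_T1 eq_sh) [<- eq_y].
  have eq_nth j : nth 0 (set_nth 0 row (find (ltn x) row) x) j =
                nth 0 (set_nth 0 row1 (find (ltn x1) row1) x1) j by rewrite eq_row.
  have lt_xy := find_ltn_at lt_p; have lt_xy1 := find_ltn_at lt_p1.
  (* At the larger position one of the two rows still has an old entry, which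
     exceeds y, while the other has the inserted letter, which does not. *)
  have eq_p : find (ltn x) row = find (ltn x1) row1.
    case: (ltngtP (find (ltn x) row) (find (ltn x1) row1)) => // lt_pp.
      have := @sorted_lt_nth row _ _ row_sorted lt_pp.
      have := eq_nth (find (ltn x1) row1); rewrite !nth_set_nth0 eqxx; case: eqP; lia.
    have := @sorted_lt_nth row1 _ _ row1_sorted lt_pp.
    have := eq_nth (find (ltn x) row); rewrite !nth_set_nth0 eqxx; case: eqP; lia.
  split; last by have := eq_nth (find (ltn x) row); rewrite !nth_set_nth0 -eq_p eqxx.
  congr cons; apply: (@eq_from_nth _ 0) => // j _.
  have := eq_nth j; rewrite !nth_set_nth0 -eq_p; case: eqP => // -> _.
  by rewrite eq_y eq_p.
- case=> /(congr1 size); rewrite size_set_nth size_rcons => *; exfalso; lia.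
- case=> /(congr1 size); rewrite size_set_nth size_rcons => *; exfalso; lia.
- by case=> /rcons_inj [-> ->] ->.
Qed.

(** Reverse insertion from the corner of [T'] in row [p]: in row 0 the last entry
    is simply taken out, and a lower corner sends a letter [y] out of the rows
    below, which [above_unbump] then exchanges in the first row. *)
Lemma row_insert_surj p l T' : tableau T' -> uniq (flatten T') -> is_part l ->
  shape T' = incr_nth l p ->
  exists T x, [/\ tableau T, shape T = l & row_insert x T = T'].
Proof.
elim: p l T' => [|p IH] [|a l] [|row' T'] //=.
- by case: T' row' => // -[|x [|//]] // _ _ _ _; exists [::], x.
- case=> row'_n0 row'_sorted [le_sz lt_col] tab_T'.
  case/lastP: row' row'_n0 row'_sorted le_sz lt_col
    => [//|row x] _ row_sorted le_sz lt_col.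
  rewrite is_part_cons => _ /and3P [a_gt0 le_a _]; rewrite size_rcons => -[eq_a eq_l].
  have x_last j : j < size row -> nth 0 row j < x.
    move=> lt_j; have := @sorted_lt_nth _ j (size row) row_sorted lt_j.
    by rewrite size_rcons !nth_rcons lt_j ltnn eqxx; apply.
  exists (row :: T'), x; rewrite row_insert_cons /= eq_a eq_l; split=> //.
    split=> //.
    + by rewrite -size_eq0 eq_a -lt0n.
    + by move: row_sorted; case: (row) => //= z s; rewrite rcons_path => /andP [].
    have le_h : size (head [::] T') <= size row by rewrite -head_shape eq_l eq_a.
    split=> // j lt_j; have := lt_col j lt_j.
    by rewrite nth_rcons (leq_trans lt_j).
  case: ifP => // lt_f; have := @find_ltn_at x row; rewrite eq_a lt_f.
  have := x_last (find (ltn x) row); rewrite eq_a lt_f; lia.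
- by case=> row'_n0 _ _ _ _ _ [] /eqP; rewrite size_eq0 (negPf row'_n0).
- case=> row'_n0 row'_sorted above' tab_T'; rewrite cat_uniq => /and3P [_ disj uniq_T'].
  rewrite is_part_cons => /and3P [a_gt0 le_a part_l] [eq_a eq_l].
  have [T [y [tab_T sh_T eT']]] := IH l T' tab_T' uniq_T' part_l eq_l.
  have perm_T' := perm_row_insert y T; rewrite eT' in perm_T'.
  have yNrow' : y \notin row'.
    by apply: (hasPn disj); rewrite (perm_mem perm_T') mem_head.
  have yNT : y \notin head [::] T.
    have := perm_uniq perm_T'; rewrite uniq_T' /= => /esym /andP [+ _].
    by apply: contra; case: (T) => //= ? ?; rewrite mem_cat => ->.
  have sorted_T : sorted ltn (head [::] T) by case: (T) tab_T => //= ? ? [].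
  move: above'; rewrite -eT' head_row_insert.
  case/(above_unbump row'_sorted sorted_T yNrow' yNT)
    => row [x] [sorted_row above_T lt_p nth_p e'].
  have size_row : size row = a.
    by rewrite -eq_a e' size_set_nth; apply/esym/maxn_idPr.
  exists (row :: T), x; rewrite row_insert_cons /= lt_p nth_p /= size_row sh_T e'.
  by split=> //; split=> //; rewrite -size_eq0 size_row -lt0n.
Qed.

(** * Adding and removing a largest entry *)

(** Meant for [n] larger than all entries and [p <= size T]; it then inverts
    [tab_remove n] when [p] is the row of the new corner. *)
Fixpoint add_max (n p : nat) (T : seq (seq nat)) {struct T} :
    seq (seq nat) :=
  match T, p with
  | row :: T', p'.+1 => row :: add_max n p' T'
  | row :: T', 0 => rcons row n :: T'
  | [::], _ => [:: [:: n]]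
  end.

Lemma perm_add_max n p T : perm_eq (flatten (add_max n p T)) (n :: flatten T).
Proof.
elim: T p => [|row T IH] [|p] //=; first by rewrite -cats1 -catA -cat1s perm_catCA.
apply: (@perm_trans _ (row ++ n :: flatten T)); first by rewrite perm_cat2l.
by rewrite -cat1s perm_catCA.
Qed.

Lemma shape_add_max n p T :
  p <= size T -> shape (add_max n p T) = incr_nth (shape T) p.
Proof.
elim: T p => [|row T IH] [|p] //=; first by rewrite size_rcons.
by rewrite ltnS => /IH ->.
Qed.

Lemma incr_nth_part_le l p : is_part (incr_nth l p) -> p <= size l.
Proof.
elim: l p => [|a l IH] [|p] //=; last by rewrite is_part_cons ltnS => /and3P [_ _ /IH].
by rewrite is_part_cons.
Qed.

Lemma tableau_rows_n0 T : tableau T -> [::] \notin T.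
Proof.
by elim: T => //= row T IH [row_n0 _ _ /IH]; rewrite inE eq_sym negb_or row_n0.
Qed.

Lemma filter_neq (n : nat) s : n \notin s -> [seq y <- s | y != n] = s.
Proof. by move=> nNs; apply/all_filterP/allP => y ys; apply: contraNneq nNs => <-. Qed.

Lemma tab_remove_cons n row T :
  tab_remove n (row :: T) =
    let row' := [seq y <- row | y != n] in
    if row' != [::] then row' :: tab_remove n T else tab_remove n T.
Proof. by []. Qed.

Lemma tab_remove_notin n T :
  [::] \notin T -> n \notin flatten T -> tab_remove n T = T.
Proof.
elim: T => [//|row T IH]; rewrite inE mem_cat !negb_or eq_sym.
case/andP=> row_n0 nilNT /andP [nNrow nNT]; rewrite tab_remove_cons.
rewrite (filter_neq nNrow) /=.
by rewrite row_n0 IH.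
Qed.

Lemma filter_rcons_max (n : nat) row : n \notin row ->
  [seq y <- rcons row n | y != n] = row.
Proof.
move=> nNrow; rewrite filter_rcons eqxx /=.
exact: filter_neq.
Qed.

Lemma tab_remove_add_max n p T :
  [::] \notin T -> n \notin flatten T -> tab_remove n (add_max n p T) = T.
Proof.
elim: T p => [|row T IH] p nilNT; first by rewrite /tab_remove /= eqxx.
have := nilNT; rewrite inE negb_or eq_sym => /andP [row_n0 nilNT'].
rewrite mem_cat negb_or => /andP [nNrow nNT].
case: p => [|p]; rewrite [add_max _ _ _]/= tab_remove_cons.
  by rewrite /= filter_rcons_max // row_n0 tab_remove_notin.
rewrite (filter_neq nNrow) /=.
by rewrite row_n0 IH.
Qed.

(** Nothing lies below or to the right of the new corner, so only the entries
    above and to the left of it matter, and they are smaller than [n]. *)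
Lemma tableau_add_max n p T : tableau T -> all (gtn n) (flatten T) ->
  is_part (incr_nth (shape T) p) -> tableau (add_max n p T).
Proof.
elim: T p => [|row T IH] p; first by [].
case=> row_n0 row_sorted [le_sz lt_col] tab_T; rewrite all_cat => /andP [lt_row lt_T].
case: p => [|p]; rewrite [incr_nth _ _]/= is_part_cons [add_max _ _ _]/=
    => /and3P [_ le_h part].
  split=> //.
  - by rewrite -size_eq0 size_rcons.
  - case: (row) row_sorted lt_row => //= z s; rewrite rcons_path => -> /andP [z_lt s_lt] /=.
    have /allP : all (gtn n) (z :: s) by rewrite /= z_lt.
    by apply; apply: mem_last.
  split=> [|j lt_j]; first by rewrite size_rcons; lia.
  by rewrite nth_rcons (leq_trans lt_j le_sz) lt_col.
split=> //; last exact: IH.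
have h_sz : size (head [::] (add_max n p T)) <= size row.
  by rewrite -head_shape shape_add_max // -[size T](size_map size) incr_nth_part_le.
split=> // j lt_j.
have lt_row_n k : k < size row -> nth 0 row k < n.
  by move=> lt_k; apply: (allP lt_row); apply: mem_nth.
case: p T {IH le_h part tab_T lt_T} le_sz lt_col h_sz lt_j => [|p] [|row2 T] //=.
- by move=> _ _ sz j0; case: j j0 => // _; apply: lt_row_n.
- rewrite size_rcons => le_sz lt_col sz; rewrite nth_rcons ltnS leq_eqVlt.
  case/orP=> [/eqP ->|lt_j].
    by rewrite ltnn eqxx; apply: lt_row_n.
  by rewrite lt_j lt_col.
- by move=> _ _ sz; case: j => // _; apply: lt_row_n.
- by move=> _ lt_col _; apply: lt_col.
Qed.

Lemma sorted_max_last n row : sorted ltn row -> all (geq n) row -> n \in row ->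
  row = rcons [seq y <- row | y != n] n.
Proof.
case/lastP: row => [//|row x]; rewrite all_rcons => row_sorted /andP [/= x_le /allP row_le].
rewrite mem_rcons inE => n_in.
have x_last j : j < size row -> nth 0 row j < x.
  move=> lt_j; have := @sorted_lt_nth _ j (size row) row_sorted lt_j.
  by rewrite size_rcons !nth_rcons lt_j ltnn eqxx; apply.
have nNrow : n \notin row.
  apply/negP => /(nthP 0) [j lt_j ej].
  by have := leq_trans (x_last j lt_j) x_le; rewrite ej ltnn.
by move: n_in; rewrite (negPf nNrow) orbF => /eqP <-; rewrite filter_rcons_max.
Qed.

(** A largest entry ends its row, and if its row consists of it alone, that row is
    the last one; so [tab_remove] drops one corner, even when it deletes an
    emptied row. *)
Lemma add_max_tab_remove n T : tableau T -> uniq (flatten T) ->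
    all (geq n) (flatten T) -> n \in flatten T ->
  exists p, p <= size (tab_remove n T) /\ T = add_max n p (tab_remove n T).
Proof.
elim: T => [//|row T IH] [row_n0 row_sorted [le_sz lt_col] tab_T].
rewrite [flatten _]/= cat_uniq all_cat mem_cat => /and3P [_ disj uniq_T] /andP [le_row le_T].
rewrite tab_remove_cons; case: (boolP (n \in row)) => [n_row _ | nNrow /= nT].
  have nNT : n \notin flatten T by apply: contraL n_row => /(hasPn disj).
  rewrite (tab_remove_notin (tableau_rows_n0 tab_T)) //=.
  have := sorted_max_last row_sorted le_row n_row.
  case: eqP => [-> /= e_row | _ /= e_row]; last by exists 0; rewrite -e_row.
  exists 0; case: T tab_T {IH disj uniq_T nNT} le_T le_sz lt_col => [|row2 T].
    by rewrite /= -e_row.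
  case=> row2_n0 _ _ _; rewrite /= all_cat => /andP [/allP le_row2 _] _ /(_ 0).
  rewrite lt0n size_eq0 row2_n0 e_row /= => /(_ isT).
  move=> lt_n; have /le_row2 : nth 0 row2 0 \in row2 by rewrite mem_nth // lt0n size_eq0.
  by rewrite /= leqNgt lt_n.
have [p [le_p eT]] := IH tab_T uniq_T le_T nT.
rewrite (filter_neq nNrow) /=.
by rewrite row_n0; exists p.+1; rewrite /= -eT.
Qed.

(** A row that loses its last entry [n] is still as long as the next row, which
    would otherwise have an entry below [n], hence larger than [n]. *)
Lemma tableau_of_add_max n p T : tableau (add_max n p T) ->
  p <= size T -> [::] \notin T -> all (gtn n) (flatten T) -> tableau T.
Proof.
elim: T p => [//|row T IH] p; rewrite inE negb_or eq_sym [flatten _]/= all_cat.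
move=> + + /andP [row_n0 nilNT] /andP [lt_row lt_T].
case: p => [|p] /=.
  case=> _ sorted' [le_sz lt_col] tab_T _; split=> //.
    by move: sorted'; case: (row) => //= z s; rewrite rcons_path => /andP [].
  have le_h : size (head [::] T) <= size row.
    rewrite leqNgt; apply/negP => lt_h; have := lt_col _ lt_h.
    rewrite nth_rcons ltnn eqxx ltnNge ltnW //; apply: (allP lt_T).
    by case: (T) lt_h => //= h T0 lt_h; rewrite mem_cat mem_nth.
  split=> // j lt_j; have := lt_col j lt_j.
  by rewrite nth_rcons (leq_trans lt_j).
rewrite ltnS => -[_ row_sorted above_T tab_T] le_p; split=> //; last exact: (IH p).
case: (T) p above_T {IH tab_T le_p} => [|row2 T'] [|p] //= [le_sz lt_col].
split=> [|j lt_j]; first by move: le_sz; rewrite size_rcons => /ltnW.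
by have := lt_col j; rewrite size_rcons nth_rcons lt_j; apply; apply: ltnW.
Qed.

Lemma sumn_incr_nth l p : sumn (incr_nth l p) = (sumn l).+1.
Proof.
elim: l p => [|a l IH] [|p] //=; last by rewrite IH addnS.
by elim: p.
Qed.

(** The row of the corner occupied by [n] can be read off the shapes before and
    after the removal; equal shapes before it also exclude that only one of the
    two tableaux contains [n]. *)
Lemma tab_remove_inj n T T1 : tableau T -> tableau T1 ->
  uniq (flatten T) -> uniq (flatten T1) ->
  all (geq n) (flatten T) -> all (geq n) (flatten T1) ->
  shape T = shape T1 -> tab_remove n T = tab_remove n T1 -> T = T1.
Proof.
move=> tab_T tab_T1 uniq_T uniq_T1 le_T le_T1 eq_sh eq_rm.
case: (boolP (n \in flatten T)) => [nT | nNT];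
  case: (boolP (n \in flatten T1)) => [nT1 | nNT1].
- have [p [le_p eT]] := add_max_tab_remove tab_T uniq_T le_T nT.
  have [p1 [le_p1 eT1]] := add_max_tab_remove tab_T1 uniq_T1 le_T1 nT1.
  move: eq_sh; rewrite eT eT1 eq_rm !shape_add_max // -?eq_rm //.
  by move=> /incr_nth_inj ->.
- have [p [le_p eT]] := add_max_tab_remove tab_T uniq_T le_T nT.
  move: (congr1 sumn eq_sh); rewrite eT shape_add_max // eq_rm.
  rewrite [tab_remove n T1]tab_remove_notin ?tableau_rows_n0 // sumn_incr_nth; lia.
- have [p [le_p eT1]] := add_max_tab_remove tab_T1 uniq_T1 le_T1 nT1.
  move: (congr1 sumn eq_sh); rewrite eT1 shape_add_max // -eq_rm.
  rewrite [tab_remove n T]tab_remove_notin ?tableau_rows_n0 // sumn_incr_nth; lia.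
- by move: eq_rm; rewrite !tab_remove_notin ?tableau_rows_n0.
Qed.

(** * Relabelling *)

Lemma head_map_rows (f : nat -> nat) (T : seq (seq nat)) :
  head [::] [seq [seq f y | y <- row] | row <- T] = [seq f y | y <- head [::] T].
Proof. by case: T. Qed.

Lemma tableau_map (f : nat -> nat) (T : seq (seq nat)) :
  {mono f : x y / x < y} ->
  tableau [seq [seq f y | y <- row] | row <- T] <-> tableau T.
Proof.
move=> f_mono; elim: T => [//|row T IH]; rewrite /= head_map_rows.
have above_map r1 r2 : above [seq f y | y <- r1] [seq f y | y <- r2] <-> above r1 r2.
  rewrite /above !size_map; split=> -[le_sz lt_col]; split=> // j lt_j.
    have := lt_col j lt_j.
    by rewrite !(nth_map 0) ?f_mono // (leq_trans lt_j).
  by rewrite !(nth_map 0) ?f_mono ?lt_col // (leq_trans lt_j).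
rewrite -!size_eq0 size_map (mono_sorted f_mono).
by split=> -[? ? /above_map ? /IH ?].
Qed.

Lemma bump_mono i : {mono bump i : x y / x < y}.
Proof. by move=> x y; rewrite /bump; lia. Qed.

(** * Tuples of tableaux *)

Section Tuples.

Variable r : nat.
Implicit Types (G H : {ffun 'I_r -> seq (seq nat)}).
Implicit Types (L M : {ffun 'I_r -> seq nat}).

(** The union of the sets [E L] over the tuples [L] of rank [m]. *)
Definition standard m G :=
  (forall t, tableau (G t)) /\ perm_eq (entries G) (iota 1 m).

Lemma count_entries a G :
  count a (entries G) = \sum_(t < r) count a (flatten (G t)).
Proof. by rewrite /entries count_flatten -map_comp sumnE big_map big_enum. Qed.

Lemma mem_entries G t y : y \in flatten (G t) -> y \in entries G.
Proof.
by move=> yG; apply/flattenP; exists (flatten (G t)); last by [];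
  apply: map_f; rewrite mem_enum.
Qed.

Lemma perm_entries_add x t G H :
  (forall u, perm_eq (flatten (H u)) (nseq (u == t) x ++ flatten (G u))) ->
  perm_eq (entries H) (x :: entries G).
Proof.
move=> perm_H; apply/permP => a.
rewrite /= !count_entries (eq_bigr (fun u => (u == t) * a x + count a (flatten (G u)))).
  by rewrite big_split -big_distrl /= -big_mkcond sum1_card card1 mul1n.
by move=> u _; rewrite (permP (perm_H u)) count_cat count_nseq mulnC.
Qed.

Lemma perm_entries_shift i G :
  perm_eq (entries (shift i G)) [seq bump i y | y <- entries G].
Proof.
apply/permP => a; rewrite count_map !count_entries; apply: eq_bigr => t _.
by rewrite ffunE -count_map map_flatten.
Qed.

(** Relabelling by [bump i] frees exactly the value [i]. *)
Lemma perm_bump_iota i m : 1 <= i <= m.+1 ->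
  perm_eq (i :: [seq bump i y | y <- iota 1 m]) (iota 1 m.+1).
Proof.
move=> i_bd; apply: uniq_perm; rewrite ?iota_uniq //=.
  rewrite map_inj_uniq ?iota_uniq ?andbT; last exact: (can_inj (bumpK i)).
  by apply/mapP => -[y _ /eqP]; rewrite (negPf (neq_bump i y)).
move=> y; rewrite -[_ :: iota _ _]/(iota 1 m.+1) inE mem_iota; apply/orP/idP.
  by case=> [/eqP -> | /mapP [z + ->]]; rewrite ?mem_iota /bump; lia.
move=> y_bd; case: (eqVneq y i) => [-> | ny]; [by left | right].
apply/mapP; exists (unbump i y); last by rewrite unbumpKcond (negPf ny).
by rewrite mem_iota /unbump; lia.
Qed.

Lemma rank_shape G : rank (tuple_shape G) = size (entries G).
Proof.
rewrite -(count_predT (entries G)) count_entries; apply: eq_bigr => t _.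
by rewrite ffunE count_predT size_flatten.
Qed.

Lemma rank_standard m G : standard m G -> rank (tuple_shape G) = m.
Proof. by case=> _ /perm_size; rewrite size_iota rank_shape. Qed.

Lemma Yr_shape m G : standard m G -> Yr (tuple_shape G).
Proof. by case=> tab_G _ t; rewrite ffunE; have /tableauP [] := tab_G t. Qed.

Lemma uniq_component m G t : standard m G -> uniq (flatten (G t)).
Proof.
case=> _ perm_G; have : uniq (entries G) by rewrite (perm_uniq perm_G) iota_uniq.
rewrite /entries; elim: (enum 'I_r) (mem_enum 'I_r t) => //= u s IH.
rewrite inE cat_uniq => /orP [/eqP -> | ts] /and3P [//] _ _; exact: IH.
Qed.

Lemma entry_le m G t : standard m G -> all (geq m) (flatten (G t)).
Proof.
case=> _ perm_G; apply/allP => y /mem_entries.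
by rewrite (perm_mem perm_G) mem_iota /=; lia.
Qed.

Lemma E_standard L G : E L G <-> standard (rank L) G /\ tuple_shape G = L.
Proof.
split.
  case=> tab_G sh_G perm_G; split=> //; split=> // t.
  by have /partial_tableauP [] := tab_G t.
case=> std_G sh_G; have [tab_G perm_G] := std_G; split=> // t.
by apply/partial_tableauP; split; first exact: uniq_component _ std_G.
Qed.

Lemma rank_covers M L : covers M L -> rank M = (rank L).+1.
Proof.
case=> t [p ->]; rewrite /rank (eq_bigr (fun u => (u == t) + sumn (L u))).
  by rewrite big_split /= -big_mkcond sum1_card card1.
by move=> u _; rewrite ffunE; case: eqP => // _; rewrite sumn_incr_nth.
Qed.

(** * Deletion steps *)

Lemma remove_add_max n G t p H :
  (forall u, [::] \notin H u) -> (forall u, n \notin flatten (H u)) ->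
  G = [ffun u => if u == t then add_max n p (H u) else H u] -> remove n G = H.
Proof.
move=> nilNH nNH ->; apply/ffunP => u; rewrite !ffunE; case: eqP => _.
  exact: tab_remove_add_max.
exact: tab_remove_notin.
Qed.

Lemma perm_entries_add_max n t p H :
  perm_eq (entries [ffun u => if u == t then add_max n p (H u) else H u])
          (n :: entries H).
Proof.
apply: (@perm_entries_add n t) => u; rewrite ffunE; case: eqP => _ //=.
exact: perm_add_max.
Qed.

Lemma perm_iota_rcons n s :
  perm_eq (n.+1 :: s) (iota 1 n.+1) = perm_eq s (iota 1 n).
Proof.
rewrite -addn1 iotaD add1n addn1 perm_sym perm_catC /= perm_cons.
exact: perm_sym.
Qed.

Lemma remove_standard n G : standard n.+1 G ->
  standard n (remove n.+1 G) /\
  covers (tuple_shape G) (tuple_shape (remove n.+1 G)).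
Proof.
move=> std_G; have [tab_G perm_G] := std_G.
have : n.+1 \in entries G by rewrite (perm_mem perm_G) mem_iota; lia.
case/flattenP => _ /mapP [t _ ->] n_t.
have notin u : u != t -> n.+1 \notin flatten (G u).
  have : uniq (entries G) by rewrite (perm_uniq perm_G) iota_uniq.
  move/count_uniq_mem => /(_ n.+1); rewrite count_entries (bigD1 t) //=.
  move=> cnt nut; have := leq_b1 (n.+1 \in entries G); rewrite -cnt (bigD1 u) //=.
  move: n_t; rewrite -!has_pred1 !has_count; case: (count _ (flatten (G t))) => // c _.
  by rewrite addSn ltnS leqn0 !addn_eq0 => /and3P [_ /eqP ->].
have [p [le_p eGt]] := add_max_tab_remove (tab_G t) (uniq_component _ std_G)
  (entry_le _ std_G) n_t.
have rmE u : u != t -> remove n.+1 G u = G u.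
  by move=> nut; rewrite ffunE tab_remove_notin ?tableau_rows_n0 ?notin.
have eG : G = [ffun u => if u == t then add_max n.+1 p (remove n.+1 G u)
                        else remove n.+1 G u].
  apply/ffunP => u; rewrite ffunE; case: eqP => [-> | /eqP /rmE -> //].
  by rewrite ffunE.
have perm_H : perm_eq (entries (remove n.+1 G)) (iota 1 n).
  rewrite -perm_iota_rcons; apply: perm_trans perm_G.
  by rewrite {2}eG perm_sym perm_entries_add_max.
split; first split=> // u.
- case: (eqVneq u t) => [-> | /rmE -> //]; rewrite ffunE.
  apply: (@tableau_of_add_max n.+1 p) => //; first by rewrite -eGt.
    by rewrite mem_filter eqxx.
  apply/allP => y yH; have : y \in entries (remove n.+1 G).
    by apply: (@mem_entries _ t); rewrite ffunE.
  by rewrite (perm_mem perm_H) mem_iota /=; lia.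
exists t, p; apply/ffunP => u; rewrite !ffunE; case: eqP => [-> | /eqP nut].
  by rewrite {1}eGt shape_add_max.
by rewrite tab_remove_notin ?tableau_rows_n0 ?notin.
Qed.

Lemma remove_inj n G G1 : standard n G -> standard n G1 ->
  tuple_shape G = tuple_shape G1 -> remove n G = remove n G1 -> G = G1.
Proof.
move=> std_G std_G1 /ffunP eq_sh /ffunP eq_rm; apply/ffunP => t.
have := eq_sh t; have := eq_rm t; rewrite !ffunE => eq_t eq_sh_t.
by apply: (@tab_remove_inj n) => //;
  [case: std_G | case: std_G1 | exact: uniq_component _ std_G
  | exact: uniq_component _ std_G1 | exact: entry_le | exact: entry_le].
Qed.

Lemma remove_surj n H L : standard n H -> Yr L -> covers L (tuple_shape H) ->
  exists G, [/\ standard n.+1 G, tuple_shape G = L & remove n.+1 G = H].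
Proof.
move=> std_H YL [t [p eL]]; have [tab_H perm_H] := std_H.
exists [ffun u => if u == t then add_max n.+1 p (H u) else H u].
have part_t : is_part (incr_nth (shape (H t)) p).
  by have := YL t; rewrite eL !ffunE eqxx.
have le_p : p <= size (H t) by rewrite -[size _](size_map size) incr_nth_part_le.
have ltH u : all (gtn n.+1) (flatten (H u)) := entry_le _ std_H.
split.
- split=> [u|]; last first.
    by rewrite (perm_trans (perm_entries_add_max _ _ _ _)) ?perm_iota_rcons.
  by rewrite ffunE; case: eqP => // ->; apply: tableau_add_max.
- by apply/ffunP => u; rewrite eL !ffunE; case: eqP => // ->; rewrite shape_add_max.
apply: (@remove_add_max _ _ t p) => // u; first exact: tableau_rows_n0.
by apply/negP => /(allP (ltH u)); rewrite /= ltnn.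
Qed.

(** * Insertion steps *)

Lemma perm_entries_insert x H :
  perm_eq (entries (insert x H)) (x.1 :: [seq bump x.1 y | y <- entries H]).
Proof.
apply: (@perm_trans _ (x.1 :: entries (shift x.1 H))); last first.
  by rewrite perm_cons perm_entries_shift.
apply: (@perm_entries_add x.1 x.2) => u; rewrite ffunE; case: eqP => _ //=.
exact: perm_row_insert.
Qed.

Lemma shape_shift i H t : shape (shift i H t) = shape (H t).
Proof. by rewrite ffunE /shape -map_comp; apply: eq_map => row /=; rewrite size_map. Qed.

Lemma insertE x H u : insert x H u =
  if u == x.2 then row_insert x.1 (shift x.1 H u) else shift x.1 H u.
Proof. by rewrite ffunE. Qed.

Lemma insert_covers x H : covers (tuple_shape (insert x H)) (tuple_shape H).
Proof.
have [p sh_p] := shape_row_insert x.1 (shift x.1 H x.2).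
exists x.2, p; apply/ffunP => u; rewrite !ffunE -/(shift _ _).
have := shape_shift x.1 H u; rewrite ffunE => sh_u.
by case: eqP => [eu | _ //]; move: sh_p; rewrite -eu ffunE sh_u.
Qed.

Lemma tableau_shift i H t : tableau (shift i H t) <-> tableau (H t).
Proof. by rewrite ffunE; apply: tableau_map (bump_mono i). Qed.

Lemma insert_standard n x H : standard n H -> 1 <= x.1 <= n.+1 ->
  standard n.+1 (insert x H).
Proof.
move=> std_H x_bd; have [tab_H perm_H] := std_H; split=> [u|].
  rewrite ffunE; case: eqP => _; last exact/tableau_shift.
  apply: tableau_row_insert; first exact/tableau_shift.
  rewrite ffunE -map_flatten /= map_inj_uniq ?(uniq_component _ std_H) ?andbT.
    by apply/mapP => -[y _ /eqP]; rewrite (negPf (neq_bump _ y)).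
  exact: (can_inj (bumpK _)).
apply: perm_trans (perm_entries_insert x H) _.
apply: perm_trans (perm_bump_iota x_bd).
by rewrite perm_cons perm_map.
Qed.

(** Insertion enlarges the component of the inserted color only, so the shapes
    give the color; [row_insert_inj] in that component gives the letter, and the
    letter determines the relabelling, which is injective. *)
Lemma insert_inj m x x1 H H1 : standard m H -> standard m H1 ->
  tuple_shape H = tuple_shape H1 -> insert x H = insert x1 H1 ->
  x = x1 /\ H = H1.
Proof.
move=> [tab_H _] [tab_H1 _] /ffunP eq_sh /ffunP eq_ins.
have sh_u i u : shape (shift i H u) = shape (shift x1.1 H1 u).
  by rewrite !shape_shift; have := eq_sh u; rewrite !ffunE.
have not_self y T : shape (row_insert y T) <> shape T.
  have [p ->] := shape_row_insert y T => /(congr1 sumn).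
  by rewrite sumn_incr_nth; lia.
have eq_t : x.2 = x1.2.
  apply/eqP/negPn/negP => nt; have := eq_ins x.2; rewrite !insertE eqxx (negPf nt).
  by move=> /(congr1 shape); rewrite -(sh_u x.1) => /not_self.
have [eq_shift_t eq_i] : shift x.1 H x.2 = shift x1.1 H1 x.2 /\ x.1 = x1.1.
  apply: row_insert_inj; rewrite ?tableau_shift //; try exact/tableau_shift.
  by have := eq_ins x.2; rewrite !insertE eq_t eqxx.
split; first by rewrite [x]surjective_pairing [x1]surjective_pairing eq_i eq_t.
apply/ffunP => u.
have : shift x.1 H u = shift x.1 H1 u.
  case: (eqVneq u x.2) => [-> | nu]; first by rewrite {2}eq_i.
  by have := eq_ins u; rewrite !insertE -eq_t (negPf nu) -eq_i.
by rewrite !ffunE => /inj_map; apply; apply: inj_map (can_inj (bumpK _)).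
Qed.

(** Reverse insertion in the component that grew yields a letter [i] which does
    not occur elsewhere, so every other entry is in the image of [bump i] and
    [unbump i] undoes the relabelling. *)
Lemma insert_surj n G L : standard n.+1 G -> Yr L -> covers (tuple_shape G) L ->
  exists x H, [/\ standard n H, tuple_shape H = L, 1 <= x.1 <= n.+1 &
    insert x H = G].
Proof.
move=> std_G YL [t [p /ffunP eL]]; have [tab_G perm_G] := std_G.
have sh_t : shape (G t) = incr_nth (L t) p by have := eL t; rewrite !ffunE eqxx.
have [T [i [tab_T sh_T ins_T]]] :=
  row_insert_surj (tab_G t) (uniq_component _ std_G) (YL t) sh_t.
pose K : {ffun 'I_r -> seq (seq nat)} := [ffun u => if u == t then T else G u].
have perm_K : perm_eq (i :: entries K) (entries G).
  rewrite perm_sym; apply: (@perm_entries_add i t) => u; rewrite ffunE.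
  by case: eqP => [-> | _] //=; rewrite -ins_T perm_row_insert.
have uniq_iK : uniq (i :: entries K).
  by rewrite (perm_uniq perm_K) (perm_uniq perm_G) iota_uniq.
have i_bd : 1 <= i <= n.+1.
  have : i \in entries G by rewrite -(perm_mem perm_K) mem_head.
  by rewrite (perm_mem perm_G) mem_iota; lia.
pose H : {ffun 'I_r -> seq (seq nat)} :=
  [ffun u => [seq [seq unbump i y | y <- row] | row <- K u]].
have shift_H : shift i H = K.
  apply/ffunP => u; rewrite !ffunE -map_comp -[RHS]map_id.
  apply/eq_in_map => row rowK /=.
  rewrite -map_comp -[RHS]map_id; apply/eq_in_map => y y_row /=.
  rewrite unbumpKcond; case: eqP => // ey; case/andP: uniq_iK => /negP [].
  by apply: (@mem_entries _ u); rewrite -ey; apply/flattenP; exists row; rewrite // ffunE.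
have ins_H : insert (i, t) H = G.
  apply/ffunP => u; rewrite ffunE /= shift_H ffunE; case: eqP => // ->.
  by rewrite ins_T.
exists (i, t), H; split=> //.
- split=> [u|].
    apply/(tableau_shift i); rewrite shift_H ffunE; case: eqP => // _; exact: tab_T.
  apply: (perm_map_inj (can_inj (bumpK i))); rewrite -(perm_cons i).
  apply: perm_trans (_ : perm_eq _ (iota 1 n.+1)) _;
    last by rewrite perm_sym perm_bump_iota.
  apply: perm_trans perm_G; rewrite -ins_H perm_sym.
  exact: (perm_entries_insert (i, t) H).
apply/ffunP => u; rewrite ffunE -(shape_shift i) shift_H ffunE.
by have := eL u; rewrite !ffunE; case: eqP => [-> | _].
Qed.

(** * Walks and the iterated map *)

(** The condition of [VT] on a list of shapes, by recursion from its head; [up]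
    is the direction of the first step, so that a tail of a walk is a walk. *)
Fixpoint zigzag (up : bool) (D : seq {ffun 'I_r -> seq nat}) : Prop :=
  if D is L :: D' then
    [/\ Yr L,
        if D' is M :: _ then if up then covers M L else covers L M else True &
        zigzag (~~ up) D']
  else True.

Lemma zigzagP up D L : zigzag up D <->
  (forall j, j < size D -> Yr (nth L D j)) /\
  (forall j, j.+1 < size D ->
     if up (+) odd j then covers (nth L D j.+1) (nth L D j)
     else covers (nth L D j) (nth L D j.+1)).
Proof.
elim: D up => [//|M D IH] up /=; split.
  case=> YM step /IH [YD steps]; split=> [[|j] //|[|j]]; first exact: YD.
    by case: D step {IH YD steps} => //= N D; rewrite addbF.
  by move=> /steps /=; rewrite addNb addbN.
case=> YD steps; split; first exact: (YD 0).
  by case: D {IH YD} steps => // N D /(_ 0 isT); rewrite addbF.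
apply/IH; split=> j lt_j; first exact: (YD j.+1).
by have := steps j.+1 lt_j; rewrite /= addNb addbN.
Qed.

Lemma zigzag_rcons up D M L : zigzag up (rcons (M :: D) L) <->
  [/\ zigzag up (M :: D), Yr L &
      if up (+) odd (size D) then covers L (last M D) else covers (last M D) L].
Proof.
elim: D up M => [|N D IH] up M.
  by rewrite /= addbF; split=> [[? ? []]|[[]]].
rewrite rcons_cons /=; split.
  by case=> YM step /IH [] *; split=> //; rewrite addbN -addNb.
case=> -[YM step zz] YL last_step; split=> //; apply/IH; split=> //.
by rewrite addNb -addbN.
Qed.

Lemma VT_zigzag m L M D : VT m L M D <->
  [/\ size D = m.+1, zigzag false D, head L D = L & last L D = M].
Proof.
split.
  case=> sz YD e0 em steps; split=> //; last by rewrite -nth_last sz.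
  by apply/(zigzagP _ _ L); rewrite sz; split.
case=> sz /(zigzagP _ _ L); rewrite sz => -[YD steps] e0 em; split=> //.
by rewrite -em -nth_last sz.
Qed.

Lemma head_del_ins n G s L :
  head L (map (@tuple_shape r) (del_ins n G s)) = tuple_shape G.
Proof. by case: s. Qed.

Lemma size_del_ins n G s : size (del_ins n G s) = (size s).*2.+1.
Proof. by elim: s G => //= x s IH G; rewrite IH. Qed.

Lemma last_del_ins n G s G1 : last G1 (del_ins n G s) = last G (del_ins n G s).
Proof. by case: s. Qed.

Definition letters_in n (s : seq (nat * 'I_r)) := all (fun x => 1 <= x.1 <= n) s.

Lemma del_ins_standard n G s : standard n G -> letters_in n s ->
  standard n (last G (del_ins n G s)) /\
  zigzag false (map (@tuple_shape r) (del_ins n G s)).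
Proof.
elim: s G => [|x s IH] G std_G.
  by split=> //; split=> //; exact: Yr_shape std_G.
move=> /= /andP [x_bd s_bd]; case: n IH std_G x_bd s_bd => [|n] IH std_G x_bd s_bd.
  by lia.
have [std_H cov_H] := remove_standard std_G.
have std_I := insert_standard std_H x_bd.
have [std_last zz] := IH _ std_I s_bd.
rewrite (last_del_ins _ (insert x (remove n.+1 G))); split=> //.
split=> //; first exact: Yr_shape std_G.
split=> //; first exact: Yr_shape std_H.
by case: s {IH s_bd std_last zz} => [|z s]; apply: insert_covers.
Qed.

(** The first tuples are determined last: by induction the tuples after the first
    insertion agree, and the first three shapes then undo that insertion and the
    deletion before it. *)
Lemma del_ins_inj n G G1 s s1 : standard n G -> standard n G1 ->
  letters_in n s -> letters_in n s1 ->
  last G (del_ins n G s) = last G1 (del_ins n G1 s1) ->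
  map (@tuple_shape r) (del_ins n G s) =
    map (@tuple_shape r) (del_ins n G1 s1) ->
  G = G1 /\ s = s1.
Proof.
elim: s G G1 s1 => [|x s IH] G G1 [|x1 s1] //=.
move=> std_G std_G1 /andP [x_bd s_bd] /andP [x1_bd s1_bd].
rewrite (last_del_ins _ (insert x (remove n G))).
rewrite (last_del_ins _ (insert x1 (remove n G1))) => eq_last [eq_G eq_H eq_D].
case: n IH std_G std_G1 x_bd s_bd x1_bd s1_bd eq_last eq_G eq_H eq_D
  => [|n]; first by lia.
move=> IH std_G std_G1 x_bd s_bd x1_bd s1_bd eq_last eq_G eq_H eq_D.
have [std_H _] := remove_standard std_G; have [std_H1 _] := remove_standard std_G1.
have [eq_ins ->] := IH _ _ _ (insert_standard std_H x_bd)
  (insert_standard std_H1 x1_bd) s_bd s1_bd eq_last eq_D.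
have [-> eq_rm] := insert_inj std_H std_H1 eq_H eq_ins.
by rewrite (remove_inj std_G std_G1 eq_G eq_rm).
Qed.

(** The input is built backwards along the walk, from the last tuple to the
    first. *)
Lemma del_ins_surj n k D G' L : standard n G' -> zigzag false D ->
  size D = k.*2.+1 -> last L D = tuple_shape G' ->
  exists G s, [/\ standard n G, size s = k, letters_in n s,
    last G (del_ins n G s) = G' & map (@tuple_shape r) (del_ins n G s) = D].
Proof.
move=> std_G'; elim: k D L => [|k IH] [|M [|N D]] L //=.
  by move=> _ _ ->; exists G', [::].
case=> YM cov_MN [YN cov_D zz] [sz_D] last_D.
have {}last_D : last N D = tuple_shape G' by [].
have [G1 [s [std_G1 sz_s s_bd last_s eq_D]]] := IH D N zz sz_D last_D.
have cov_1N : covers (tuple_shape G1) N.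
  by move: cov_D; rewrite -eq_D; case: (s).
case: n {IH} std_G' std_G1 s_bd last_s eq_D => [|n] std_G' std_G1 s_bd last_s eq_D.
  (* A tuple of rank 0 covers nothing. *)
  by have := rank_covers cov_1N; rewrite (rank_standard std_G1).
have [x [H [std_H sh_H x_bd ins_H]]] := insert_surj std_G1 YN cov_1N.
rewrite -sh_H in cov_MN.
have [G [std_G sh_G rm_G]] := remove_surj std_H YM cov_MN.
exists G, (x :: s); split=> //=.
- by rewrite sz_s.
- by rewrite x_bd.
- by rewrite rm_G ins_H (last_del_ins _ G1).
by rewrite rm_G ins_H eq_D sh_G sh_H.
Qed.

End Tuples.

Unset Implicit Arguments.
Set Strict Implicit.

Local Open Scope classical_set_scope.

Theorem mainTheorem5 (r n k : nat) (hr : 1 <= r)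
    (Theta : {ffun 'I_r -> seq nat}) (hTheta : Yr_rank n Theta) :
  set_bij (E Theta `*` @colored_words r n k)
          (\bigcup_(L in @Yr_rank r n) (E L `*` VT k.*2 Theta L))
          (@phi r n)
  /\
  (1 <= n ->
   set_bij (E Theta `*` @colored_words r n k)
           (\bigcup_(L in @Yr_rank r n.-1) (E L `*` VT k.*2.+1 Theta L))
           (@phi_half r n)).
Proof.
case: hTheta => _ rank_Theta.
have E_Theta G : E Theta G <-> standard n G /\ tuple_shape G = Theta.
  by rewrite E_standard rank_Theta.
have targetP m q v : (\bigcup_(L in @Yr_rank r m) (E L `*` VT q Theta L)) v <->
    standard m v.1 /\ VT q Theta (tuple_shape v.1) v.2.
  split; first by case=> L [_ <-] [/E_standard [std_v eL]]; rewrite eL.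
  case=> std_v VT_v; have rk := rank_standard std_v.
  exists (tuple_shape v.1); first by split=> //; apply: Yr_shape std_v.
  by split=> //; apply/E_standard; rewrite rk.
have phi_VT u : (E Theta `*` @colored_words r n k) u ->
    standard n (phi n u).1 /\
    VT k.*2 Theta (tuple_shape (phi n u).1) (phi n u).2.
  case: u => G s [/E_Theta [std_G sh_G] [sz_s s_bd]].
  have [std_last zz] := del_ins_standard std_G s_bd.
  split=> //; apply/VT_zigzag; split=> //=.
  - by rewrite size_map size_del_ins sz_s.
  - by rewrite head_del_ins.
  - by case: (s) => [|x s'] //=; rewrite last_map.
have phi_inj u v : (E Theta `*` @colored_words r n k) u ->
    (E Theta `*` @colored_words r n k) v -> phi n u = phi n v -> u = v.
  case: u v => [G s] [G1 s1].
  case=> /E_Theta [std_G _] [_ s_bd] [/E_Theta [std_G1 _] [_ s1_bd]].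
  case=> eq_last eq_D; by have [/= -> /= ->] :=
    del_ins_inj std_G std_G1 s_bd s1_bd eq_last eq_D.
have phi_surj G' D : standard n G' -> VT k.*2 Theta (tuple_shape G') D ->
    exists2 u, (E Theta `*` @colored_words r n k) u & phi n u = (G', D).
  move=> std_G' /VT_zigzag [sz_D zz head_D last_D].
  have [G [s [std_G sz_s s_bd last_s eq_D]]] := del_ins_surj std_G' zz sz_D last_D.
  exists (G, s); last by rewrite /phi last_s eq_D.
  by split=> //=; apply/E_Theta; split=> //; rewrite -head_D -eq_D head_del_ins.
split; [split | move=> n_gt0; split].
- by move=> u /phi_VT ?; apply/targetP.
- by move=> u v /set_mem src_u /set_mem src_v; apply: phi_inj.
- by case=> G' D /targetP [std_G' VT_D]; apply: phi_surj.
all: case: n n_gt0 rank_Theta E_Theta phi_VT phi_inj phi_surj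
  => // n _ rank_Theta E_Theta phi_VT phi_inj phi_surj.
- move=> u /phi_VT; rewrite /phi_half; case: (phi n.+1 u) => G [|M D].
    by case=> _ /VT_zigzag [].
  case=> /= std_G /VT_zigzag [/= [sz_D] + eM]; rewrite eM => zz last_D.
  apply/targetP.
  have [std_H cov_H] := remove_standard std_G; split=> //.
  apply/VT_zigzag; split=> //; last by rewrite /= last_rcons.
    by rewrite /= size_rcons sz_D.
  apply/zigzag_rcons; split=> //; first exact: Yr_shape std_H.
  by rewrite sz_D odd_double /= last_D.
- move=> u v /set_mem src_u /set_mem src_v.
  have := phi_inj u v src_u src_v; have := phi_VT u src_u; have := phi_VT v src_v.
  rewrite /phi_half; case: (phi n.+1 u) (phi n.+1 v) => [G D] [G1 D1] /=.
  case=> std_G1 /VT_zigzag [_ _ _ last_D1] [std_G /VT_zigzag [_ _ _ last_D]] inj.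
  case=> eq_rm /rcons_inj [eq_D _]; apply: inj.
  have eq_sh : tuple_shape G = tuple_shape G1 by rewrite -last_D -last_D1 eq_D.
  by rewrite eq_D (remove_inj std_G std_G1 eq_sh eq_rm).
- case=> H D /targetP [/= std_H /VT_zigzag [sz_D zz head_D last_D]].
  case/lastP: D sz_D zz head_D last_D => [//|[|M D] L] //.
  rewrite size_rcons last_rcons => -[sz_D] /zigzag_rcons [zz YL cov] /= eM eL.
  rewrite sz_D odd_double /= eL in cov.
  have YM : Yr (last M D).
    by have /(zigzagP _ _ M) [YD _] := zz; rewrite (last_nth M); apply: YD.
  have [G' [std_G' sh_G' rm_G']] := remove_surj std_H YM cov.
  have [|u src_u eq_u] := phi_surj G' (M :: D) std_G'.
    by apply/VT_zigzag; split=> //=; rewrite sz_D.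
  by exists u; rewrite // /phi_half eq_u /= rm_G' eL.
Qed.
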